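(* Let $q\ge 3$ be a power of a prime $p$. The curve $\mathcal{Z}=\mathcal{Y}/\Phi$ (the quotient curve of the DGZ curve $\mathcal{C}$ by the Sylow $p$-subgroup $Q=T\rtimes\Phi$ of $PGL(3,q)\le\mathrm{Aut}(\mathcal{C})$) is isomorphic to the Fermat curve of degree $q-1$, i.e. to the curve with equation $x^{q-1}+y^{q-1}+z^{q-1}=0$.
   Context: Let $\mathbb{K}=\overline{\mathbb{F}}_q$. Put $D_1(x,y,z)=\begin{vmatrix} x & x^q & x^{q^3}\\ y & y^q & y^{q^3}\\ z & z^q & z^{q^3}\end{vmatrix}$, $D_2(x,y,z)=\begin{vmatrix} x & x^q & x^{q^2}\\ y & y^q & y^{q^2}\\ z & z^q & z^{q^2}\end{vmatrix}$ and $F=D_1/D_2$, an absolutely irreducible homogeneous polynomial of degree $q^3-q^2$ over $\mathbb{F}_q$. The DGZ curve $\mathcal{C}$ is the plane curve over $\mathbb{K}$ with equation $F(x,y,z)=0$; its function field is $\mathbb{K}(\mathcal{C})=\mathbb{K}(x,y)$ with $F(x,y,1)=0$. For a finite group $G$ of automorphisms of a curve, the quotient curve by $G$ is the nonsingular curve whose function field is the fixed field of $G$. $PGL(3,q)$ acts on $\mathcal{C}$ by linear substitutions. $T$ is the group of order $q^2$ of translations $(x,y)\mapsto(x+\alpha,y+\beta)$, $\alpha,\beta\in\mathbb{F}_q$; $\Phi$ is the group of order $q$ of maps $(x,y)\mapsto(x,\gamma x+y)$, $\gamma\in\mathbb{F}_q$; and $Q=T\rtimes\Phi$ is a Sylow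 $p$-subgroup of $PGL(3,q)$, of order $q^3$. $\mathcal{Y}=\mathcal{C}/T$; as $\Phi$ normalizes $T$, it acts on $\mathcal{Y}$, and $\mathcal{Z}=\mathcal{Y}/\Phi=\mathcal{C}/Q$. Isomorphism is over $\mathbb{K}$, between nonsingular models (equivalently, $\mathbb{K}$-isomorphism of function fields). *)

(* Defs.v *)
From HB Require Import structures.
From mathcomp Require Import all_boot all_order all_algebra.
From mathcomp Require Import mpoly.

Set Implicit Arguments.
Unset Strict Implicit.
Unset Printing Implicit Defensive.

Import GRing.Theory.
Local Open Scope ring_scope.

Definition is_algebraic_closure (k : fieldType) (K : closedFieldType)
    (iota : {rmorphism k -> K}) : Prop :=
  forall u : K, algebraicOver iota u.

Section PlaneCurves.

Variable K : fieldType.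

(* In D1 and D2, row i is made of powers of the i-th coordinate 'X_i. *)
Definition DGZ_D1 (q : nat) : {mpoly K[3]} :=
  \det (\matrix_(i < 3, j < 3) 'X_i ^+ (q ^ tnth [tuple 0; 1; 3]%N j)).

Definition DGZ_D2 (q : nat) : {mpoly K[3]} :=
  \det (\matrix_(i < 3, j < 3) 'X_i ^+ (q ^ tnth [tuple 0; 1; 2]%N j)).

(* F = D1 / D2; F is unique because D2 is nonzero for q > 1. *)
Definition is_DGZ_form (q : nat) (F : {mpoly K[3]}) : Prop :=
  F * DGZ_D2 q = DGZ_D1 q.

Definition fermat_form (d : nat) : {mpoly K[3]} :=
  \sum_(i < 3) 'X_i ^+ d.

(* F (X, Y, 1) *)
Definition dehomogenize (F : {mpoly K[3]}) : {mpoly K[2]} :=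
  F \mPo [tuple 'X_0; 'X_1; 1].

Variables (L : fieldType) (j : {rmorphism K -> L}).

Definition eval2 (x y : L) (g : {mpoly K[2]}) : L :=
  mmap j (tnth [tuple x; y]) g.

(* L, with constants embedded by j, is the function field K(x, y) of the
   irreducible plane curve F = 0: it is the fraction field of
   K[X, Y] / (F (X, Y, 1)), and x, y are the classes of X, Y. This determines
   (L, j, x, y) up to a unique isomorphism. *)
Record is_function_field (F : {mpoly K[3]}) (x y : L) : Prop :=
  IsFunctionField {
    ff_relations : forall g : {mpoly K[2]},
      eval2 x y g = 0 <-> exists h, g = h * dehomogenize F;
    ff_generated : forall z : L, exists g h : {mpoly K[2]},
      eval2 x y h != 0 /\ z = eval2 x y g / eval2 x y h
  }.

Definition is_K_automorphism (s : {rmorphism L -> L}) : Prop :=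
  bijective s /\ forall c : K, s (j c) = j c.

End PlaneCurves.

(* An automorphism of the curve is represented by the K-automorphism it induces
   on the function field K(x, y); T, Phi and Q are closed under inverses, so
   the choice between pullback along g and along g^-1 is immaterial. *)
Section Groups.

Variables (k K L : fieldType) (iota : {rmorphism k -> K}).
Variables (j : {rmorphism K -> L}) (x y : L).

Definition group_T (s : {rmorphism L -> L}) : Prop :=
  is_K_automorphism j s /\
  exists a b : k, s x = x + j (iota a) /\ s y = y + j (iota b).

Definition group_Phi (s : {rmorphism L -> L}) : Prop :=
  is_K_automorphism j s /\
  exists c : k, s x = x /\ s y = j (iota c) * x + y.

Definition group_Q (s : {rmorphism L -> L}) : Prop :=
  exists t f : {rmorphism L -> L},
    [/\ group_T t, group_Phi f & s =1 t \o f].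

End Groups.

Definition in_fixed_field (L : fieldType) (G : {rmorphism L -> L} -> Prop)
    (z : L) : Prop :=
  forall s, G s -> s z = z.

(* The quotient by G of the curve with function field (L, jL) is isomorphic to
   the curve with function field (M, jM): some K-embedding of M into L, which
   is automatically injective, has the fixed field of G as its image. *)
Definition quotient_isomorphic (K L M : fieldType)
    (jL : {rmorphism K -> L}) (G : {rmorphism L -> L} -> Prop)
    (jM : {rmorphism K -> M}) : Prop :=
  exists phi : {rmorphism M -> L},
    (forall c : K, phi (jM c) = jL c) /\
    (forall z : L, in_fixed_field G z <-> exists m : M, phi m = z).

(* Main.v *)
(* Put [a = x^q - x], [b = y^q - y] and [c = b^q - a^(q-1) b]. Cancelling
   [D_2 (X, Y, 1) = a b^q - b a^q = a c] turns the equation of the DGZ curve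
   into [1 + c^(q-1) + (a^q)^(q-1) = 0], that is [c^(q-1) = - (a^(q-1) + 1)^q]; so
   [w = c / (a^(q-1) + 1)] satisfies the Fermat equation
   [a^(q-1) + w^(q-1) + 1 = 0]. Both [a] and [c] are invariant under [Q], and
   [x], [y] are roots over [K(a, w)] of the monic polynomials [X^q - X - a] and
   [(Y^q - Y)^q - a^(q-1) (Y^q - Y) - c], of degrees [q] and [q^2], all of whose
   roots are [Q]-conjugates; hence the fixed field is exactly [K(a, w)]. *)
Require Import Defs.
From HB Require Import structures.
From mathcomp Require Import all_boot all_order all_algebra all_field.
From mathcomp Require Import mpoly ring.

Set Implicit Arguments.
Unset Strict Implicit.
Unset Printing Implicit Defensive.

Import GRing.Theory.
Local Open Scope ring_scope.

(** * Evaluation of bivariate polynomials *)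

Section Eval2.
Variables (K L : fieldType) (j : {rmorphism K -> L}) (x y : L).

HB.instance Definition _ :=
  GRing.RMorphism.copy (eval2 j x y) (mmap j (tnth [tuple x; y])).

Lemma eval2C c : eval2 j x y c%:MP = j c.
Proof. exact: mmapC. Qed.

Lemma eval2X0 : eval2 j x y 'X_0 = x.
Proof. by rewrite /eval2 mmapX mmap1U. Qed.

Lemma eval2X1 : eval2 j x y 'X_1 = y.
Proof. by rewrite /eval2 mmapX mmap1U. Qed.

End Eval2.

Lemma rmorph_mmap n (R : nzRingType) (S T : comNzRingType)
    (s : {rmorphism S -> T}) (f : {rmorphism R -> S}) (h : 'I_n -> S) g :
  s (mmap f h g) = mmap (s \o f) (s \o h) g.
Proof.
rewrite /mmap rmorph_sum; apply: eq_bigr => m _ /=.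
rewrite rmorphM /mmap1 rmorph_prod; congr (_ * _).
by apply: eq_bigr => i _; rewrite rmorphXn.
Qed.

Lemma eq_mmap n (R S : nzRingType) (f f' : R -> S) (h h' : 'I_n -> S) g :
  f =1 f' -> h =1 h' -> mmap f h g = mmap f' h' g.
Proof.
move=> eq_f eq_h; rewrite /mmap; apply: eq_bigr => m _.
by rewrite eq_f (mmap1_eq _ eq_h).
Qed.

Lemma rmorph_eval2 (K L N : fieldType) (j : {rmorphism K -> L})
    (j' : {rmorphism K -> N}) (s : {rmorphism L -> N}) x y g :
    (forall c, s (j c) = j' c) ->
  s (eval2 j x y g) = eval2 j' (s x) (s y) g.
Proof.
move=> s_j; rewrite /eval2 rmorph_mmap; apply: eq_mmap => // i /=.
by rewrite !(tnth_nth 0); case: i => [[|[]]].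
Qed.

Lemma eval2_comp (K L : fieldType) (j : {rmorphism K -> L}) x y g G0 G1 :
  eval2 j x y (g \mPo [tuple G0; G1]) =
  eval2 j (eval2 j x y G0) (eval2 j x y G1) g.
Proof.
rewrite /comp_mpoly (rmorph_mmap (eval2 j x y)); apply: eq_mmap => [c|i] /=.
  exact: eval2C.
by rewrite !(tnth_nth 0); case: i => [[|[]]].
Qed.

(** * Homomorphisms out of a function field *)

Section Lift.
Variables (K L N : fieldType) (jL : {rmorphism K -> L}).
Variables (jN : {rmorphism K -> N}) (F : {mpoly K[3]}) (x y : L) (x' y' : N).
Hypothesis ffL : is_function_field jL F x y.

Lemma rmorph_function_field_ext (s t : {rmorphism L -> N}) :
  (forall c, s (jL c) = t (jL c)) -> s x = t x -> s y = t y -> s =1 t.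
Proof.
move=> eq_st sx sy z; have [g [h [_ ->]]] := ff_generated ffL z.
rewrite !fmorph_div.
by rewrite !(rmorph_eval2 (j' := t \o jL)) //= sx sy.
Qed.

Hypothesis same_relations :
  forall g, eval2 jL x y g = 0 <-> eval2 jN x' y' g = 0.

(** The fraction is packed into one pair with a boolean condition, so that [xchoose] can select a
    representative for each [z]. *)
Let generated_bool z : exists gh : {mpoly K[2]} * {mpoly K[2]},
  (eval2 jL x y gh.2 != 0) && (z == eval2 jL x y gh.1 / eval2 jL x y gh.2).
Proof.
have [g [h [h0 zE]]] := ff_generated ffL z.
by exists (g, h); rewrite h0 zE eqxx.
Qed.

Let fraction z := xchoose (generated_bool z).
Let lift z := eval2 jN x' y' (fraction z).1 / eval2 jN x' y' (fraction z).2.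

(** The forward half of [same_relations] makes the value independent of the selected fraction; the
    backward half keeps denominators nonzero. *)
Let lift_frac g h : eval2 jL x y h != 0 ->
  lift (eval2 jL x y g / eval2 jL x y h) =
  eval2 jN x' y' g / eval2 jN x' y' h.
Proof.
have nz f : eval2 jL x y f != 0 -> eval2 jN x' y' f != 0.
  by apply: contraNneq => /same_relations ->.
rewrite /lift /fraction => h0; case: (xchoose _) (xchooseP (generated_bool
  (eval2 jL x y g / eval2 jL x y h))) => g' h' /= /andP[h'0].
rewrite eqr_div // -!rmorphM -subr_eq0 -rmorphB => /eqP/same_relations/eqP.
by rewrite rmorphB subr_eq0 !rmorphM -eqr_div ?nz // => /eqP.
Qed.

Let liftE g : lift (eval2 jL x y g) = eval2 jN x' y' g.
Proof.
have := @lift_frac g 1; rewrite !rmorph1 !divr1; apply; exact: oner_neq0.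
Qed.

Let lift_zmod : zmod_morphism lift.
Proof.
move=> z1 z2; have [g1 [h1 [h10 ->]]] := ff_generated ffL z1.
have [g2 [h2 [h20 ->]]] := ff_generated ffL z2.
have nz f : eval2 jL x y f != 0 -> eval2 jN x' y' f != 0.
  by apply: contraNneq => /same_relations ->.
rewrite -mulNr addf_div // -!rmorphN -!rmorphM -rmorphD.
rewrite !lift_frac ?rmorphM ?mulf_neq0 //.
by rewrite rmorphD !rmorphM rmorphN -addf_div ?nz // mulNr.
Qed.

Let lift_monoid : monoid_morphism lift.
Proof.
split=> [|z1 z2]; first by have := liftE 1; rewrite !rmorph1.
have [g1 [h1 [h10 ->]]] := ff_generated ffL z1.
have [g2 [h2 [h20 ->]]] := ff_generated ffL z2.
rewrite mulf_div -!rmorphM !lift_frac ?rmorphM ?mulf_neq0 //.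
by rewrite mulf_div.
Qed.

HB.instance Definition _ := GRing.isZmodMorphism.Build L N lift lift_zmod.
HB.instance Definition _ := GRing.isMonoidMorphism.Build L N lift lift_monoid.

Lemma function_field_lift : exists s : {rmorphism L -> N},
  [/\ forall c, s (jL c) = jN c, s x = x' & s y = y'].
Proof.
exists lift; split=> [c||] /=.
- by rewrite -(eval2C jL x y) liftE eval2C.
- by have := liftE 'X_0; rewrite !eval2X0.
- by have := liftE 'X_1; rewrite !eval2X1.
Qed.

End Lift.

(** * Descent along conjugates, and inverting algebraic elements *)

Lemma poly_const_on_roots (R : idomainType) (P : {poly R}) (rs : seq R) z :
    (size P <= size rs)%N -> (0 < size rs)%N -> uniq rs ->
    {in rs, forall r, P.[r] = z} ->
  P = z%:P.
Proof.
(* Otherwise [P - z%:P] is nonzero with at least as many roots as its size. The condition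
   [0 < size rs] bounds the size of the constant [z%:P]. *)
move=> szP rs0 Urs Pz; apply/eqP; rewrite -subr_eq0; apply/negPn/negP => nz.
have /(max_poly_roots nz)/(_ Urs) : all (root (P - z%:P)) rs.
  by apply/allP => r /Pz Pr; rewrite rootE !hornerE Pr subrr.
rewrite ltnNge (leq_trans (size_polyD _ _)) // geq_max szP size_polyN.
by rewrite (leq_trans (size_polyC_leq1 z)).
Qed.

(* With [rs] the conjugates of a root of [f], this says that an element of
   [e(R)[r]] invariant under conjugation belongs to [e(R)]. *)
Lemma horner_const_on_conjugates (R : nzRingType) (L : fieldType)
    (e : {rmorphism R -> L}) (f P : {poly R}) (rs : seq L) z :
    f \is monic -> size f = (size rs).+1 -> (0 < size rs)%N -> uniq rs ->
    {in rs, forall r, (map_poly e f).[r] = 0} ->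
    {in rs, forall r, (map_poly e P).[r] = z} ->
  exists c : R, e c = z.
Proof.
move=> mon_f szf rs0 Urs f0 Pz.
(* The remainder takes the same values on [rs], and its degree is below the number of conjugates, so
   its image is constant. *)
pose Q := Pdiv.Ring.rmodp P f.
exists Q`_0; rewrite -coef_map.
rewrite (@poly_const_on_roots _ (map_poly e Q) rs z) ?coefC //.
  rewrite (leq_trans (size_poly _ _)) // -ltnS -szf.
  by rewrite Pdiv.Ring.ltn_rmodpN0 ?monic_neq0.
move=> r rin; rewrite -(Pz r rin) [in RHS](Pdiv.RingMonic.rdivp_eq mon_f P).
by rewrite rmorphD rmorphM hornerD hornerM f0 // mulr0 add0r.
Qed.

(* The cofactor of the norm of [z], up to sign, is a polynomial in [z]. *)
Lemma algebraic_dvd_const (R : nzRingType) (L : idomainType)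
    (e : {rmorphism R -> L}) (P : {poly R}) z :
    P != 0 -> (map_poly e P).[z] = 0 -> z != 0 ->
  exists (Q : {poly R}) (r : R), r != 0 /\ e r = z * (map_poly e Q).[z].
Proof.
elim/poly_ind: P => [|P c IH]; first by rewrite eqxx.
(* If the constant term is zero, a factor ['X] is cancelled, as [z != 0]. Otherwise the constant
   term is the required [r], with cofactor [- P]. *)
have [->|c0] := eqVneq c 0.
  rewrite addr0 => PX0; rewrite rmorphM /= map_polyX hornerMX => /eqP.
  rewrite mulf_eq0 => /orP[/eqP Pz z0|->//]; apply: IH => //.
  by apply: contraNneq PX0 => ->; rewrite mul0r.
move=> _; rewrite rmorphD rmorphM /= map_polyX map_polyC /=.
rewrite hornerD hornerMX hornerC => Pc _; exists (- P), c; split=> //.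
by apply/eqP; rewrite rmorphN hornerN mulrN -addr_eq0 addrC mulrC Pc.
Qed.

(** * The invariants of Q and the affine DGZ equation *)

Section Invariants.
Variable R : comNzRingType.
Variable q : nat.

Definition artin_schreier (x : R) := x ^+ q - x.

(** Over the field with q elements, this is the product of all [y + c x + d], that is the quotient
    of the Moore determinants of [1, x, y] and of [1, x]. *)
Definition dickson (x y : R) :=
  artin_schreier y ^+ q - artin_schreier x ^+ (q - 1) * artin_schreier y.

Definition dgz (x y : R) :=
  1 + dickson x y ^+ (q - 1) + (artin_schreier x ^+ q) ^+ (q - 1).

Hypothesis q_gt0 : (0 < q)%N.
(** Additivity is assumed in this form because the identities serve both in [{mpoly K[2]}] and in
    the function field [L]. *)
Hypothesis frobD : forall u v : R, (u + v) ^+ q = u ^+ q + v ^+ q.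

Lemma frobB (u v : R) : (u - v) ^+ q = u ^+ q - v ^+ q.
Proof. by apply/eqP; rewrite eq_sym subr_eq -frobD subrK. Qed.

Lemma exprB1M (u : R) : u * u ^+ (q - 1) = u ^+ q.
Proof. by rewrite -exprS subn1 prednK. Qed.

Lemma artin_schreier_shift (x c : R) :
  c ^+ q = c -> artin_schreier (x + c) = artin_schreier x.
Proof. by move=> cq; rewrite /artin_schreier frobD cq; ring. Qed.

Lemma dickson_shift (x y c d : R) :
  c ^+ q = c -> d ^+ q = d -> dickson (x + c) (y + d) = dickson x y.
Proof. by move=> cq dq; rewrite /dickson !artin_schreier_shift. Qed.

(** The shear replaces [b] by [b + c a]; the new terms [c a^q] and [a^(q-1) c a] cancel. *)
Lemma dickson_shear (x y c : R) :
  c ^+ q = c -> dickson x (c * x + y) = dickson x y.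
Proof.
move=> cq; rewrite /dickson.
have -> : artin_schreier (c * x + y) = c * artin_schreier x + artin_schreier y.
  by rewrite /artin_schreier frobD exprMn cq; ring.
by rewrite frobD exprMn cq -(exprB1M (artin_schreier x)); ring.
Qed.

Lemma dgz_shift (x y c d : R) :
  c ^+ q = c -> d ^+ q = d -> dgz (x + c) (y + d) = dgz x y.
Proof. by move=> cq dq; rewrite /dgz dickson_shift // artin_schreier_shift. Qed.

Lemma dgz_shear (x y c : R) : c ^+ q = c -> dgz x (c * x + y) = dgz x y.
Proof. by move=> cq; rewrite /dgz dickson_shear. Qed.

Lemma det_powers (x y : R) (e1 e2 : nat) :
  \det (\matrix_(i < 3, j < 3)
     tnth [tuple x; y; 1] i ^+ (q ^ tnth [tuple 0; e1; e2]%N j)) =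
  (x ^+ (q ^ e1) - x) * (y ^+ (q ^ e2) - y)
  - (y ^+ (q ^ e1) - y) * (x ^+ (q ^ e2) - x).
Proof.
rewrite (expand_det_row _ ord0) !big_ord_recl big_ord0 /cofactor.
rewrite !(expand_det_row _ ord0) !big_ord_recl !big_ord0 /cofactor !det_mx11.
rewrite !mxE !(tnth_nth 0) /= !expr1n !expn0 !expr1 /bump /=.
by ring.
Qed.

(* Subtracting the last row from the others, only the powers of
   [a = x^q - x] and [b = y^q - y] remain. *)
Lemma dgz_det (x y : R) :
  dgz x y * \det (\matrix_(i < 3, j < 3)
     tnth [tuple x; y; 1] i ^+ (q ^ tnth [tuple 0; 1; 2]%N j)) =
  \det (\matrix_(i < 3, j < 3)
     tnth [tuple x; y; 1] i ^+ (q ^ tnth [tuple 0; 1; 3]%N j)).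
Proof.
rewrite !det_powers /dgz.
have pow2 (z : R) : z ^+ (q ^ 2) = artin_schreier z ^+ q + artin_schreier z + z.
  by rewrite expnS expn1 exprM /artin_schreier frobB; ring.
have pow3 (z : R) : z ^+ (q ^ 3) =
    (artin_schreier z ^+ q) ^+ q + artin_schreier z ^+ q + artin_schreier z + z.
  rewrite expnSr exprM pow2 !frobD -[RHS]addrA; congr (_ + _).
  by rewrite /artin_schreier; ring.
rewrite !pow2 !pow3 expn1 -!/(artin_schreier _).
(* [ring] cannot relate the exponents [q] and [q - 1]. These four equations express the [q]-th
   powers through [a], [b], [dickson x y] and powers of exponent [q - 1], which then act as
   atoms. *)
have aq := exprB1M (artin_schreier x).
have bq : artin_schreier y ^+ q =
    dickson x y + artin_schreier x ^+ (q - 1) * artin_schreier y.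
  by rewrite /dickson subrK.
have aqq := exprB1M (artin_schreier x ^+ q).
have bqq : (artin_schreier y ^+ q) ^+ q = dickson x y * dickson x y ^+ (q - 1) +
   (artin_schreier x ^+ q) ^+ (q - 1) * artin_schreier y ^+ q.
  by rewrite {1}bq frobD exprMn exprB1M -!exprM [(q * (q - 1))%N]mulnC.
rewrite bqq -aqq bq.
move: (dickson x y ^+ (q - 1)) ((artin_schreier x ^+ q) ^+ (q - 1)) => C S.
by rewrite -aq; ring.
Qed.

End Invariants.

Lemma rmorph_artin_schreier (R S : comNzRingType) (q : nat)
    (s : {rmorphism R -> S}) x :
  s (artin_schreier q x) = artin_schreier q (s x).
Proof. by rewrite /artin_schreier rmorphB rmorphXn. Qed.

Lemma rmorph_dickson (R S : comNzRingType) (q : nat)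
    (s : {rmorphism R -> S}) x y :
  s (dickson q x y) = dickson q (s x) (s y).
Proof.
by rewrite /dickson rmorphB rmorphM !rmorphXn !rmorph_artin_schreier.
Qed.

Lemma rmorph_dgz (R S : comNzRingType) (q : nat) (s : {rmorphism R -> S}) x y :
  s (dgz q x y) = dgz q (s x) (s y).
Proof.
by rewrite /dgz !rmorphD rmorph1 !rmorphXn rmorph_dickson rmorph_artin_schreier.
Qed.

Lemma closed_field_artin_schreier (K : closedFieldType) (q : nat) (e : K) :
  (1 < q)%N -> exists z : K, artin_schreier q z = e.
Proof.
move=> q_gt1.
(* These coefficients encode the equation [z ^+ q = e + z]. *)
have [z zE] := solve_monicpoly (fun i => if i == 0%N then e else (i == 1%N)%:R)
  (ltnW q_gt1).
exists z; rewrite /artin_schreier zE.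
case: q q_gt1 {zE} => [|[|q]] // _; rewrite !big_ord_recl big1 => [|i _] /=.
  by rewrite expr0 expr1; ring.
by rewrite mul0r.
Qed.

Lemma mpoly_pchar_nat (K : nzRingType) (m q : nat) :
  [pchar K].-nat q -> [pchar {mpoly K[m]}].-nat q.
Proof. by apply: sub_in_pnat => p _; apply: (rmorph_pchar (@mpolyC m K)). Qed.

(** By [dgz_det], both sides have the same product with [D2 (X, Y, 1)], which can be cancelled once
    it is known to be nonzero. *)
Lemma DGZ_formE (K : closedFieldType) (q : nat) (F : {mpoly K[3]}) :
    (1 < q)%N -> [pchar K].-nat q ->
  is_DGZ_form q F -> dehomogenize F = dgz q 'X_0 'X_1.
Proof.
move=> q_gt1 q_pchar FD.
have q_gt0 : (0 < q)%N by apply: ltnW.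
have frobD (u v : {mpoly K[2]}) : (u + v) ^+ q = u ^+ q + v ^+ q.
  exact/exprDn_pchar/mpoly_pchar_nat.
pose lq : 3.-tuple {mpoly K[2]} := [tuple 'X_0; 'X_1; 1].
have detE (e : 3.-tuple nat) :
    dehomogenize
      (\det (\matrix_(i < 3, j < 3) ('X_i : {mpoly K[3]}) ^+ (q ^ tnth e j))) =
    \det (\matrix_(i < 3, j < 3) tnth lq i ^+ (q ^ tnth e j)).
  rewrite /dehomogenize -(det_map_mx (comp_mpoly lq)); congr (\det _).
  apply/matrixP => i j.
  by rewrite !mxE rmorphXn /= comp_mpolyXU -tnth_nth.
have D2_neq0 : \det (\matrix_(i < 3, j < 3)
    tnth lq i ^+ (q ^ tnth [tuple 0; 1; 2]%N j)) != 0.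
  (* A point where the determinant does not vanish: with [b^q - b = 1], [a^q - a = c] and
     [c^q - c = 1], its value is [c - c^q = -1]. *)
  have [b bE] := closed_field_artin_schreier (1 : K) q_gt1.
  have [c cE] := closed_field_artin_schreier (1 : K) q_gt1.
  have [a aE] := closed_field_artin_schreier c q_gt1.
  have succ_pow (z w : K) : artin_schreier q z = w -> z ^+ q = w + z.
    by move<-; rewrite /artin_schreier subrK.
  rewrite det_powers; apply/eqP => /(congr1 (eval2 idfun a b)).
  rewrite rmorph0 rmorphB !rmorphM !rmorphB !rmorphXn /= eval2X0 eval2X1.
  rewrite -mulnn !expn1 !exprM (succ_pow _ _ aE) (succ_pow _ _ bE).
  rewrite !exprDn_pchar // expr1n (succ_pow _ _ aE) (succ_pow _ _ bE).
  rewrite (succ_pow _ _ cE) => /eqP; apply/negP.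
  set e := (e in e != 0); have -> : e = -1 by rewrite /e; ring.
  by rewrite oppr_eq0 oner_neq0.
apply: (mulIf D2_neq0); rewrite (dgz_det q_gt0 frobD) -!detE.
rewrite -/(DGZ_D1 K q) -/(DGZ_D2 K q) -FD.
by rewrite /dehomogenize rmorphM.
Qed.

(** * Integrality, constants, and evaluation of the Fermat form *)

Lemma integral_mmap n (R T : fieldType) (A : comNzRingType)
    (e : {rmorphism A -> T}) (f : {rmorphism R -> T}) (h : 'I_n -> T) g :
    (forall c, integralOver e (f c)) -> (forall i, integralOver e (h i)) ->
  integralOver e (mmap f h g).
Proof.
move=> int_f int_h; rewrite /mmap.
elim/big_ind: _ => [||m _]; [exact: integral0 | exact: integral_add |].
apply: integral_mul => //; rewrite /mmap1.
elim/big_ind: _ => [||i _]; [exact: integral1 | exact: integral_mul |].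
elim: (m i) => [|k IH]; first exact: integral1.
by rewrite exprS; apply: integral_mul.
Qed.

(** [r] splits into linear factors over [K], and one of their images must vanish at [z]. *)
Lemma closed_field_root (K : closedFieldType) (L : fieldType)
    (j : {rmorphism K -> L}) (r : {poly K}) z :
  r != 0 -> (map_poly j r).[z] = 0 -> exists c, z = j c.
Proof.
move=> r0; have [rs ->] := closed_field_poly_normal r.
rewrite map_polyZ /= rmorph_prod hornerZ horner_prod => /eqP.
rewrite mulf_eq0 fmorph_eq0 lead_coef_eq0 (negPf r0) /=.
rewrite prodf_seq_eq0 => /hasP[c _ /=].
rewrite rmorphB /= map_polyX map_polyC hornerXsubC subr_eq0 => /eqP ->.
by exists c.
Qed.

Lemma eval2_fermat (K L : fieldType) (j : {rmorphism K -> L}) (d : nat) a b :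
  eval2 j a b (dehomogenize (fermat_form K d)) = a ^+ d + b ^+ d + 1.
Proof.
rewrite /dehomogenize /fermat_form !big_ord_recl big_ord0.
rewrite !rmorphD !rmorphXn rmorph0 /= !comp_mpolyXU /= rmorph0 addr0.
by rewrite eval2X0 eval2X1 rmorph1 expr1n addrA.
Qed.

(** * The action of Q on the DGZ function field *)

Section DGZ.
Variables (q : nat) (Fq : finFieldType) (K : closedFieldType).
Variables (iota : {rmorphism Fq -> K}) (F : {mpoly K[3]}).
Variables (L : fieldType) (jL : {rmorphism K -> L}) (x y : L).
Hypotheses (q_gt1 : (1 < q)%N) (q_pchar : [pchar K].-nat q).
Hypotheses (card_Fq : #|Fq| = q) (FE : dehomogenize F = dgz q 'X_0 'X_1).
Hypothesis ffL : is_function_field jL F x y.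

Let q_gt0 : (0 < q)%N. Proof. exact: ltnW. Qed.

Let frobL (z1 z2 : L) : (z1 + z2) ^+ q = z1 ^+ q + z2 ^+ q.
Proof.
apply: exprDn_pchar; apply: sub_in_pnat q_pchar => p _; exact: rmorph_pchar.
Qed.

Let fixq (c : Fq) : jL (iota c) ^+ q = jL (iota c).
Proof. by rewrite -!rmorphXn -card_Fq expf_card. Qed.

Lemma dgz_vanish : dgz q x y = 0.
Proof.
have : eval2 jL x y (dehomogenize F) = 0.
  by apply/(ff_relations ffL); exists 1; rewrite mul1r.
by rewrite FE rmorph_dgz /= eval2X0 eval2X1.
Qed.

Let vanish g x' y' : dgz q x' y' = 0 ->
  eval2 jL x y g = 0 -> eval2 jL x' y' g = 0.
Proof.
move=> xy'0 /(ff_relations ffL)[h ->].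
by rewrite FE rmorphM rmorph_dgz /= eval2X0 eval2X1 xy'0 mulr0.
Qed.

Let dgz_affine (a b c : Fq) :
  dgz q (x + jL (iota a)) (jL (iota c) * x + y + jL (iota b)) = 0.
Proof. by rewrite dgz_shift // dgz_shear // dgz_vanish. Qed.

Let affine_rmorph (a b c : Fq) : exists s : {rmorphism L -> L},
  [/\ forall k, s (jL k) = jL k, s x = x + jL (iota a)
    & s y = jL (iota c) * x + y + jL (iota b)].
Proof.
apply: (function_field_lift ffL) => g; split; first exact: vanish.
(* For the converse, substitute the affine map into [g]. The resulting polynomial vanishes at
   [(x, y)], hence at every point of the curve over [L]; at the image of [(x, y)] under the inverse
   map, with parameters [- a], [c * a - b], [- c], it takes the value of [g] at [(x, y)]. *)
pose G0 : {mpoly K[2]} := 'X_0 + (iota a)%:MP.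
pose G1 : {mpoly K[2]} := (iota c)%:MP * 'X_0 + 'X_1 + (iota b)%:MP.
have GE x' y' : eval2 jL x' y' (g \mPo [tuple G0; G1]) =
    eval2 jL (x' + jL (iota a)) (jL (iota c) * x' + y' + jL (iota b)) g.
  rewrite eval2_comp; congr (eval2 _ _ _ _).
    by rewrite rmorphD /= eval2X0 eval2C.
  by rewrite !rmorphD rmorphM /= !eval2C eval2X0 eval2X1.
rewrite -GE => /(vanish (dgz_affine (- a) (c * a - b) (- c))).
rewrite GE !rmorphB !rmorphN !rmorphM => <-.
by congr (eval2 _ _ _ _); ring.
Qed.

Lemma affine_automorphism (a b c : Fq) : exists s : {rmorphism L -> L},
  [/\ is_K_automorphism jL s, s x = x + jL (iota a)
    & s y = jL (iota c) * x + y + jL (iota b)].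
Proof.
have [s [sj sx sy]] := affine_rmorph a b c.
have [t [tj tx ty]] := affine_rmorph (- a) (c * a - b) (- c).
exists s; split=> //; split=> //; exists t.
  apply: (rmorph_function_field_ext ffL (s := t \o s) (t := idfun)) => /=.
  - by move=> k; rewrite sj tj.
  - by rewrite sx rmorphD tx tj rmorphN; ring.
  - rewrite sy !rmorphD rmorphM !tj tx ty !(rmorphB, rmorphN, rmorphM).
    by ring.
apply: (rmorph_function_field_ext ffL (s := s \o t) (t := idfun)) => /=.
- by move=> k; rewrite tj sj.
- by rewrite tx rmorphD sx sj rmorphN; ring.
- rewrite ty !rmorphD rmorphM !sj sx sy !(rmorphB, rmorphN, rmorphM).
  by ring.
Qed.

(** In [t \o f] the shear [f] acts first, and the translation [t] is then applied to [c x + y]; this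
    produces the factor [x + a]. *)
Lemma group_Q_affine (a b c : Fq) : exists s : {rmorphism L -> L},
  [/\ group_Q iota jL x y s, s x = x + jL (iota a)
    & s y = jL (iota c) * (x + jL (iota a)) + (y + jL (iota b))].
Proof.
have [t [tj tx ty]] := affine_automorphism a b 0.
have [f [fj fx fy]] := affine_automorphism 0 0 c.
rewrite !rmorph0 ?addr0 ?mul0r ?add0r in ty fx fy.
exists (t \o f); split=> /=.
- by exists t, f; split=> //; split=> //; [exists a, b | exists c].
- by rewrite fx.
- by rewrite fy rmorphD rmorphM tx ty; case: tj => _ ->.
Qed.

(* A constant would be fixed by the automorphism [x |-> x + 1]. *)
Lemma x_not_constant k : x <> jL k.
Proof.
move=> xE; have [s [[_ sj] sx _]] := affine_automorphism 1 0 0.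
move/eqP: sx; rewrite xE sj !rmorph1 -subr_eq0 opprD addNKr oppr_eq0.
by rewrite oner_eq0.
Qed.

(** * The elements a and w and their Fermat relation *)

Local Notation a := (artin_schreier q x).
Local Notation c := (dickson q x y).

(** For nonzero [r], the polynomial [r (X^q - X)] would be nonzero with root [x], and [x] would be a
    constant because [K] is algebraically closed. *)
Lemma artin_schreier_transcendental (r : {poly K}) :
  (map_poly jL r).[a] = 0 -> r = 0.
Proof.
have szA : (1 < size ('X^q - 'X : {poly K})%R)%N.
  by rewrite size_polyDl ?size_polyN ?size_polyXn ?size_polyX ltnS.
move=> ra0; apply/eqP; rewrite -(comp_poly_eq0 _ szA); apply/negPn/negP => nz.
have [|k] := closed_field_root (j := jL) (z := x) nz.
  2: exact: x_not_constant.
by rewrite map_comp_poly horner_comp rmorphB /= map_polyXn map_polyX !hornerE.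
Qed.

Lemma den_neq0 : a ^+ (q - 1) + 1 != 0.
Proof.
apply/eqP => a1; have : 'X^(q - 1) + 1 = 0 :> {poly K}.
  apply: artin_schreier_transcendental.
  by rewrite rmorphD rmorph1 /= map_polyXn !hornerE.
move/(congr1 (fun r : {poly K} => r`_0)) => /eqP.
rewrite coefD coefXn coef1 coef0 /=.
have -> : (0 == q - 1)%N = false by rewrite eq_sym subn_eq0 leqNgt q_gt1.
by rewrite add0r oner_eq0.
Qed.

Definition fermat_v : L := c / (a ^+ (q - 1) + 1).
Local Notation w := fermat_v.

Lemma dicksonE : c = w * (a ^+ (q - 1) + 1).
Proof. by rewrite /fermat_v divfK ?den_neq0. Qed.

(* The relation [dgz x y = 0] reads [c ^ (q - 1) = - (a ^ (q - 1) + 1) ^ q]. *)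
Lemma fermat_relation : a ^+ (q - 1) + w ^+ (q - 1) + 1 = 0.
Proof.
set t := a ^+ (q - 1) + 1.
have cE : c ^+ (q - 1) = - t * t ^+ (q - 1).
  apply/eqP; rewrite mulNr (exprB1M q_gt0) -addr_eq0 /t frobL expr1n.
  by rewrite -exprM mulnC exprM; apply/eqP; rewrite -[RHS]dgz_vanish /dgz; ring.
have -> : w ^+ (q - 1) = - t.
  by rewrite exprMn exprVn cE mulfK ?expf_neq0 ?den_neq0.
by rewrite /t; ring.
Qed.

(** * Comparison of K(u, v) with K(a, w) *)

Section Fermat.
Variables (M : fieldType) (jM : {rmorphism K -> M}) (u v : M).
Hypothesis ffM : is_function_field jM (fermat_form K (q - 1)) u v.

Lemma fermat_vanish : u ^+ (q - 1) + v ^+ (q - 1) + 1 = 0.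
Proof.
rewrite -(eval2_fermat jM); apply/(ff_relations ffM).
by exists 1; rewrite mul1r.
Qed.

(** One direction is the Fermat relation for [a] and [w]. For the other, [K[u, v]] is integral over
    [K[u]], so a nonzero [g (u, v)] divides [r (u)] for some nonzero polynomial [r]. This
    divisibility persists at [(a, w)]; if [g] vanished there, then [r (a) = 0], against the
    transcendence of [a]. *)
Lemma fermat_same_relations g :
  eval2 jM u v g = 0 <-> eval2 jL a w g = 0.
Proof.
have vanishM h : eval2 jM u v h = 0 -> eval2 jL a w h = 0.
  move=> /(ff_relations ffM)[h' ->].
  by rewrite rmorphM /= eval2_fermat fermat_relation mulr0.
split=> [|gaw0]; first exact: vanishM.
apply/eqP/negPn/negP => guv_neq0.
have [e eE] : exists e : {rmorphism {poly K} -> M},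
    forall r, e r = (map_poly jM r).[u].
  by exists (horner_eval u \o map_poly jM).
have eC k : e k%:P = jM k by rewrite eE map_polyC hornerC.
have eX : e 'X = u by rewrite eE map_polyX hornerX.
have int_uv : integralOver e (eval2 jM u v g).
  apply: integral_mmap => [k|i]; first by rewrite -eC; apply: integral_id.
  rewrite (tnth_nth 0); case: i => [[|[]]] //= _.
    by have := integral_id e 'X; rewrite eX.
  (* The Fermat equation, monic in the outer variable, which stands for [v]; the inner variable
     stands for [u]. *)
  exists ('X^(q - 1) + ('X^(q - 1) + 1)%:P).
    by rewrite monicE lead_coefDl ?lead_coefXn // size_polyXn ltnS
       (leq_trans (size_polyC_leq1 _)) // subn_gt0.
  rewrite rootE rmorphD /= map_polyXn map_polyC !hornerE /=.
  rewrite rmorphD rmorphXn rmorph1 eX.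
  by apply/eqP; rewrite -[RHS]fermat_vanish; ring.
have [P monP /rootP Puv] := int_uv.
have [Q [r [r0 rE]]] := algebraic_dvd_const (monic_neq0 monP) Puv guv_neq0.
(* [E] reads a polynomial in [u] as a bivariate one in ['X_0]. The divisibility thus becomes a
   relation between [u] and [v], which [vanishM] transports. *)
pose E : {rmorphism {poly K} -> {mpoly K[2]}} :=
  horner_eval 'X_0 \o map_poly (@mpolyC 2 K).
have EE (N : fieldType) (jN : {rmorphism K -> N}) a' w' s :
    eval2 jN a' w' (E s) = (map_poly jN s).[a'].
  rewrite /E /= /horner_eval -horner_map /= eval2X0 -map_poly_comp.
  by congr (_.[_]); apply: eq_map_poly => k /=; rewrite eval2C.
have : eval2 jM u v (E r - g * (map_poly E Q).[g]) = 0.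
  rewrite rmorphB rmorphM /= EE -horner_map -map_poly_comp /=.
  rewrite -eE rE (eq_map_poly (g := e)) ?subrr //.
  by move=> s /=; rewrite EE eE.
move/vanishM/eqP; rewrite rmorphB rmorphM /= gaw0 mul0r subr0 EE => /eqP.
by move/artin_schreier_transcendental => r_eq0; rewrite r_eq0 eqxx in r0.
Qed.

(** * The fixed field of Q *)

Section Embedding.
Variable phi : {rmorphism M -> L}.
Hypotheses (phi_j : forall k, phi (jM k) = jL k) (phi_u : phi u = a).
Hypothesis phi_v : phi v = w.

Lemma group_Q_fixes_fermat s m : group_Q iota jL x y s -> s (phi m) = phi m.
Proof.
case=> t [f [[[_ tj] [a0 [b0 [tx ty]]]] [[_ fj] [c0 [fx fy]]] sE]].
apply: (rmorph_function_field_ext ffM (s := s \o phi) (t := phi)) => /=.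
- by move=> k; rewrite sE /= phi_j fj tj.
- rewrite phi_u sE /= !rmorph_artin_schreier fx tx.
  by rewrite artin_schreier_shift.
rewrite phi_v sE /fermat_v /= !fmorph_div.
rewrite rmorph_dickson fx fy (dickson_shear q_gt0) // rmorph_dickson tx ty.
rewrite dickson_shift // !rmorphD !rmorph1 !rmorphXn !rmorph_artin_schreier.
by rewrite fx tx artin_schreier_shift.
Qed.

(** Evaluation at [(x, y)] is nested so that [y] can be eliminated first, over [phi (M)[x]], and [x]
    afterwards, over [phi (M)]. *)
Let evx : {rmorphism {poly M} -> L} := horner_eval x \o map_poly phi.
Let psi : {rmorphism {poly {poly M}} -> L} := horner_eval y \o map_poly evx.

Let psiC m : psi m%:P%:P = phi m.
Proof.
by rewrite /psi /= map_polyC /horner_eval hornerC /= map_polyC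
  /horner_eval hornerC.
Qed.

Let psiX : psi 'X%:P = x.
Proof.
by rewrite /psi /= map_polyC /horner_eval hornerC /= map_polyX
  /horner_eval hornerX.
Qed.

Let psiY : psi 'X = y.
Proof. by rewrite /psi /= map_polyX /horner_eval hornerX. Qed.

Let fx : {poly M} := 'X^q - ('X + u%:P).
(** By [dicksonE], [phi] maps the last constant to [dickson q x y]. The leading power is kept apart
    from the rest because it alone determines degree and leading coefficient. *)
Let fy : {poly M} := ('X^q - 'X) ^+ q -
  ((u ^+ (q - 1))%:P * ('X^q - 'X) + (v * (u ^+ (q - 1) + 1))%:P).

Let fxE z : (map_poly phi fx).[z] = artin_schreier q z - a.
Proof.
rewrite /fx rmorphB rmorphD /= map_polyXn map_polyX map_polyC /= phi_u.
by rewrite !(hornerD, hornerN, hornerXn, hornerX, hornerC) opprD addrA.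
Qed.

Let fyE z : (map_poly phi fy).[z] = dickson q x z - c.
Proof.
rewrite /fy !(rmorphB, rmorphD, rmorphM, rmorphXn) /= !map_polyC /=.
rewrite map_polyX !(hornerD, hornerN, hornerM, horner_exp, hornerX, hornerC).
rewrite !(rmorphD, rmorphM, rmorphXn, rmorph1).
rewrite phi_u phi_v dicksonE {1}/dickson -/(artin_schreier q z).
by ring.
Qed.

Let size_XqX : size ('X^q - 'X : {poly M}) = q.+1.
Proof. by rewrite size_polyDl ?size_polyN ?size_polyXn ?size_polyX ?ltnS. Qed.

Let monic_XqX : ('X^q - 'X : {poly M}) \is monic.
Proof.
by rewrite monicE lead_coefDl ?lead_coefXn ?size_polyN ?size_polyXn ?size_polyX
  ?ltnS.
Qed.

Let size_fx : size fx = q.+1.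
Proof.
by rewrite /fx size_polyDl ?size_polyN ?size_polyXn ?size_XaddC ?ltnS.
Qed.

Let monic_fx : fx \is monic.
Proof.
by rewrite monicE lead_coefDl ?lead_coefXn ?size_polyN ?size_polyXn ?size_XaddC
  ?ltnS.
Qed.

Let size_fy_head : size (('X^q - 'X : {poly M}) ^+ q) = (q * q).+1.
Proof.
by rewrite polySpred ?expf_neq0 ?monic_neq0 // size_exp size_XqX.
Qed.

Let size_fy_tail : (size ((u ^+ (q - 1))%:P * ('X^q - 'X) +
  (v * (u ^+ (q - 1) + 1))%:P)%R < (q * q).+1)%N.
Proof.
rewrite ltnS (leq_trans (size_polyD _ _)) // geq_max mul_polyC.
rewrite (leq_trans (size_scale_leq _ _)) ?size_XqX; last first.
  by rewrite (leq_ltn_trans _ (ltn_Pmulr q_gt1 q_gt0)).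
by rewrite (leq_trans (size_polyC_leq1 _)) // muln_gt0 q_gt0.
Qed.

Let size_fy : size fy = (q * q).+1.
Proof. by rewrite /fy size_polyDl size_fy_head // size_polyN. Qed.

Let monic_fy : fy \is monic.
Proof.
rewrite monicE lead_coefDl ?size_polyN ?size_fy_head //.
by rewrite -monicE monic_exp.
Qed.

(** [x] and [y] are roots of the monic [fx] and [fy], so a denominator [h (x, y)] is integral over
    [phi (M)] and divides a nonzero element of it; its inverse is therefore a polynomial in [x] and
    [y]. *)
Lemma polynomial_in_xy z : exists P : {poly {poly M}}, z = psi P.
Proof.
have int_xy h : integralOver phi (eval2 jL x y h).
  apply: integral_mmap => [k|i]; first by rewrite -phi_j; apply: integral_id.
  rewrite (tnth_nth 0); case: i => [[|[]]] //= _.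
    by exists fx; rewrite // rootE fxE subrr.
  by exists fy; rewrite // rootE fyE subrr.
have psi_eval h : exists P, eval2 jL x y h = psi P.
  exists (mmap (polyC \o polyC \o jM) (tnth [tuple 'X%:P; 'X]) h).
  rewrite rmorph_mmap; apply: eq_mmap => [k|i].
    by rewrite -phi_j -psiC.
  rewrite (tnth_nth 0) -[RHS]/(psi (tnth _ i)) (tnth_nth 0).
  by case: i => [[|[]]].
have [g [h [h_neq0 ->]]] := ff_generated ffL z.
have [P monP /rootP Ph] := int_xy h.
have [Q [r [r0 rE]]] := algebraic_dvd_const (monic_neq0 monP) Ph h_neq0.
have [G GE] := psi_eval g; have [H HE] := psi_eval h.
(* From [phi r = h * Q (h)], the inverse of [h] is [Q (h) / phi r]. *)
exists (G * (r^-1)%:P%:P * (map_poly (polyC \o polyC) Q).[H]).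
rewrite !rmorphM -GE psiC -horner_map -HE -map_poly_comp.
rewrite (eq_map_poly (g := phi)) => [|m]; last exact: psiC.
have Qh : (map_poly phi Q).[eval2 jL x y h] = phi r / eval2 jL x y h.
  by rewrite rE mulrAC divff ?mul1r.
by rewrite Qh -mulrA [_ * (phi r / _)]mulrA -rmorphM mulVf // rmorph1 mul1r.
Qed.

(** Two descents: the elements of Q fixing [x] move [y] through all [q * q] roots of [fy], which
    puts [z] in [phi (M)[x]]; translations of [x] then move it through all [q] roots of [fx], which
    puts [z] in [phi (M)]. *)
Lemma fixed_field_sub z :
  in_fixed_field (group_Q iota jL x y) z -> exists m, phi m = z.
Proof.
move=> fix_z; have iota_inj : injective (jL \o iota) by apply: fmorph_inj.
have [P zE] := polynomial_in_xy z.
have evxE s A : group_Q iota jL x y s -> s (evx A) = (map_poly phi A).[s x].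
  move=> Qs; rewrite /evx /= /horner_eval -horner_map -map_poly_comp.
  by congr (_.[_]); apply: eq_map_poly => m /=; rewrite group_Q_fixes_fermat.
have [A AE] : exists A, evx A = z.
  pose conj_y (bc : Fq * Fq) := jL (iota bc.2) * x + (y + jL (iota bc.1)).
  have conj_y_inj : injective conj_y.
    move=> [b c] [b' c']; rewrite /conj_y /= => eq_conj.
    have [eq_c|ne_c] := eqVneq c c'.
      by move: eq_conj; rewrite eq_c => /addrI/addrI/iota_inj ->.
    have ne_jc : jL (iota (c - c')) != 0 by rewrite !fmorph_eq0 subr_eq0.
    (* Two equal conjugates with [c != c'] would force [x] to be this constant. *)
    case: (@x_not_constant (iota ((b' - b) / (c - c')))).
    apply: (mulfI ne_jc).
    rewrite -!rmorphM [(c - c') * _]mulrC divfK ?subr_eq0 //.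
    rewrite !rmorphB; apply/eqP; rewrite -subr_eq0.
    move/eqP: eq_conj; rewrite -subr_eq0 => /eqP eq_conj.
    by rewrite -[X in _ == X]eq_conj; apply/eqP; ring.
  pose rs := [seq conj_y bc | bc <- enum {: Fq * Fq}].
  have size_rs : size rs = (q * q)%N.
    by rewrite size_map -cardE card_prod card_Fq.
  have fy_evx : map_poly evx (map_poly polyC fy) = map_poly phi fy.
    rewrite -map_poly_comp; apply: eq_map_poly => m /=.
    by rewrite map_polyC /horner_eval hornerC.
  apply: (@horner_const_on_conjugates _ _ evx (map_poly polyC fy) P rs).
  - exact: monic_map.
  - by rewrite size_map_polyC size_fy size_rs.
  - by rewrite size_rs muln_gt0 q_gt0.
  - by rewrite map_inj_uniq ?enum_uniq.
  - move=> _ /mapP[[b c] _ ->]; rewrite fy_evx fyE (dickson_shear q_gt0) //.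
    by rewrite -{1}[x]addr0 dickson_shift ?subrr // expr0n; case: q q_gt0.
  move=> _ /mapP[[b c] _ ->].
  (* This [s] fixes [x] and the image of [phi], so applying it to [z = psi P] evaluates [P] at the
     conjugate of [y]. *)
  have [s [Qs sx sy]] := group_Q_affine 0 b c.
  rewrite !rmorph0 addr0 in sx sy.
  rewrite -[RHS](fix_z s Qs) zE /psi /= {2}/horner_eval -horner_map sy.
  rewrite -[in RHS]map_poly_comp; congr (_.[_]); apply: eq_map_poly => B /=.
  by have := evxE s B Qs; rewrite sx => ->.
pose rs := [seq x + jL (iota b) | b <- enum Fq].
have size_rs : size rs = q by rewrite size_map -cardE card_Fq.
apply: (@horner_const_on_conjugates _ _ phi fx A rs) => //.
- by rewrite size_fx size_rs.
- by rewrite size_rs.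
- by rewrite map_inj_uniq ?enum_uniq // => b b' /addrI/iota_inj.
- by move=> _ /mapP[b _ ->]; rewrite fxE artin_schreier_shift ?subrr.
move=> _ /mapP[b _ ->]; have [s [Qs sx _]] := group_Q_affine b 0 0.
by rewrite -[RHS](fix_z s Qs) -AE evxE // sx.
Qed.

End Embedding.

Lemma quotient_isomorphic_fermat :
  quotient_isomorphic jL (group_Q iota jL x y) jM.
Proof.
have [phi [phi_j phi_u phi_v]] :=
  function_field_lift ffM fermat_same_relations.
exists phi; split=> // z; split; first exact: fixed_field_sub.
by case=> m <- s; apply: group_Q_fixes_fermat.
Qed.

End Fermat.
End DGZ.

Theorem proposition6p5
  (p n q : nat) (p_prime : prime p) (n_gt0 : (0 < n)%N)
  (qE : q = (p ^ n)%N) (q_ge3 : (3 <= q)%N)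
  (* K is an algebraic closure of the field Fq with q elements *)
  (Fq : finFieldType) (card_Fq : #|Fq| = q)
  (K : closedFieldType) (iota : {rmorphism Fq -> K})
  (K_closure : is_algebraic_closure iota)
  (* (L, jL) = K(x, y) is the function field of the DGZ curve F = 0 *)
  (F : {mpoly K[3]}) (F_DGZ : is_DGZ_form q F)
  (L : fieldType) (jL : {rmorphism K -> L}) (x y : L)
  (L_DGZ : is_function_field jL F x y)
  (* (M, jM) = K(u, v) is the function field of the Fermat curve *)
  (M : fieldType) (jM : {rmorphism K -> M}) (u v : M)
  (M_Fermat : is_function_field jM (fermat_form K (q - 1)) u v) :
  quotient_isomorphic jL (group_Q iota jL x y) jM.
Proof.
have q_gt1 : (1 < q)%N by apply: ltnW.
have p_pchar : p \in [pchar K].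
  by apply: (rmorph_pchar iota); apply: (card_finPcharP _ p_prime);
     rewrite card_Fq qE.
have q_pchar : [pchar K].-nat q by rewrite qE pnatX pnatE ?p_pchar.
exact: (quotient_isomorphic_fermat iota q_gt1 q_pchar card_Fq
  (DGZ_formE q_gt1 q_pchar F_DGZ) L_DGZ M_Fermat).
Qed.
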